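(* Let $d\ge 1$ and, for $u=1,\dots,d$, let $g_u=\min(g_{u,1},\dots,g_{u,l_u})$ with $l_u\ge 1$ and functions $g_{u,j}:\mathbb{R}^n\to\mathbb{R}$. Let $C_{i,j}=\{x\in\mathbb{R}^n : g_{i,j}(x)\le 0\}$. Then the feasible set $C=\{x\in\mathbb{R}^n : g_u(x)\le 0,\ u=1,\dots,d\}$ satisfies $$C=\bigcap_{i=1}^d\bigcup_{j=1}^{l_i}C_{i,j}=\bigcup_{j_1=1}^{l_1}\cdots\bigcup_{j_d=1}^{l_d}\bigcap_{i=1}^dC_{i,j_i}.$$ Additionally, let $f:\mathbb{R}^n\to\mathbb{R}^m$ be such that the problem $(f,C)$ satisfies the domination property. Then, with $g=(g_1,\dots,g_d)$, $$\mathrm{PS}^{(f,g)}=\mathrm{ND}^{(f,g)}\Big(\bigcup_{j_1=1}^{l_1}\cdots\bigcup_{j_d=1}^{l_d}\mathrm{PS}^{(f,(g_{1,j_1},\dots,g_{d,j_d}))}\Big).$$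
   Context: For $f=(f_1,\dots,f_m):\mathbb{R}^n\to\mathbb{R}^m$ (to be minimized), $y$ dominates $x$, written $y\prec x$, if $f_i(y)\le f_i(x)$ for all $i$ and $f_j(y)<f_j(x)$ for some $j$. For $C\subset\mathbb{R}^n$, the Pareto set $\mathrm{PS}^{(f,C)}$ of the problem $(f,C)$ is the set of all $x\in C$ such that no $y\in C$ satisfies $y\prec x$. The problem $(f,C)$ satisfies the domination property if for all $x\in C\setminus\mathrm{PS}^{(f,C)}$ there exists $z\in\mathrm{PS}^{(f,C)}$ such that $z\prec x$. For $S\subset\mathbb{R}^n$, $\mathrm{ND}^{(f,C)}(S)$ is the set of all $y\in S\cap C$ such that no point of $S\cap C$ dominates $y$. For a vector of inequality constraint functions $g=(g_1,\dots,g_d)$, $\mathrm{PS}^{(f,g)}$ and $\mathrm{ND}^{(f,g)}$ mean $\mathrm{PS}^{(f,C)}$ and $\mathrm{ND}^{(f,C)}$ where $C=\{x : g_u(x)\le 0\ \forall u\}$ is the feasible set of $g$. *)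

(* Defs.v *)
From HB Require Import structures.
From mathcomp Require Import all_boot all_order all_algebra.
From mathcomp Require Import boolp classical_sets reals.

Set Implicit Arguments.
Unset Strict Implicit.
Unset Printing Implicit Defensive.

Import Order.TTheory GRing.Theory Num.Theory.
Local Open Scope classical_set_scope.
Local Open Scope ring_scope.

Section Pareto.
Variables (R : realType) (n m : nat) (f : 'rV[R]_n -> 'rV[R]_m).
Implicit Types (C S : set 'rV[R]_n) (x y z : 'rV[R]_n).

Definition dominates y x : Prop :=
  (forall i : 'I_m, f y 0 i <= f x 0 i) /\
  (exists j : 'I_m, f y 0 j < f x 0 j).

Definition pareto_set C : set 'rV[R]_n :=
  [set x | C x /\ ~ exists2 y, C y & dominates y x].

Definition domination_property C : Prop :=
  forall x, (C `\` pareto_set C) x ->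
    exists2 z, pareto_set C z & dominates z x.

Definition nondominated C S : set 'rV[R]_n :=
  [set y | (S `&` C) y /\ ~ exists2 z, (S `&` C) z & dominates z y].

End Pareto.

Definition feasible (R : realType) (n d : nat) (g : 'I_d -> 'rV[R]_n -> R) :
    set 'rV[R]_n :=
  [set x | forall u : 'I_d, g u x <= 0].

(* The iterated minimum needs an initial value; taking a member of the
   (nonempty) family leaves the minimum of the family unchanged. *)
Definition family_min (R : realType) (k : nat) (k_gt0 : (0 < k)%N)
    (F : 'I_k -> R) : R :=
  \big[Num.min/F (Ordinal k_gt0)]_(j < k) F j.

(* Main.v *)
(* A min is nonpositive iff one of its terms is, so C is the union of the pieces
   feasible (g_{1,j_1}, ..., g_{d,j_d}). A Pareto point of a union is Pareto in
   any piece containing it; conversely, a feasible point outside PS(C) is, by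
   the domination property, dominated by a point of PS(C), which lies in the
   union of the Pareto sets of the pieces. *)
Require Import Defs.
From HB Require Import structures.
From mathcomp Require Import all_boot all_order all_algebra.
From mathcomp Require Import boolp classical_sets reals.

Set Implicit Arguments.
Unset Strict Implicit.
Unset Printing Implicit Defensive.

Import Order.TTheory GRing.Theory Num.Theory.
Local Open Scope classical_set_scope.
Local Open Scope ring_scope.

(** The minimum of a nonempty finite family is attained, and it lies below each term. *)
Lemma family_min_le (R : realType) (k : nat) (k_gt0 : (0 < k)%N)
    (F : 'I_k -> R) (a : R) :
  family_min k_gt0 F <= a <-> exists j, F j <= a.
Proof.
rewrite /family_min; split=> [|[j Fja]]; last first.
  by rewrite (bigD1 j) //= ge_min Fja.
have [j ->] : exists j, \big[Num.min/F (Ordinal k_gt0)]_(i < k) F i = F j.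
  (* The base case holds because the initial value is itself a member of the family. *)
  apply: (big_ind (fun v => exists j, v = F j)); first by exists (Ordinal k_gt0).
    move=> _ _ [i ->] [j ->].
    by rewrite minEle; case: ifP => _; [exists i|exists j].
  by move=> i _; exists i.
by exists j.
Qed.

(** Choosing one index per [i] distributes intersection over union; a dependent function [j] encodes
    the tuple of indices, so the iterated union becomes a single one. *)
Lemma bigcap_bigcup_choice (T I : Type) (J : I -> Type)
    (A : forall i, J i -> set T) :
  \bigcap_(i : I) \bigcup_(j : J i) A i j =
    \bigcup_(j : forall i, J i) \bigcap_(i : I) A i (j i).
Proof.
apply/seteqP; split=> x /= Ax; last first.
  by case: Ax => j _ Aj i _; exists (j i) => //; exact: Aj.
have {}Ax i : exists j, A i j x by have [j _ Aj] := Ax i Logic.I; exists j.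
by exists (fun i => sval (cid (Ax i))) => // i _; exact: svalP (cid (Ax i)).
Qed.

(** The constraints enter the Pareto identity only through the decomposition of [C] into pieces,
    hence the arbitrary family [D]. *)
Lemma pareto_set_bigcup (R : realType) (n m : nat) (f : 'rV[R]_n -> 'rV[R]_m)
    (I : Type) (D : I -> set 'rV[R]_n) :
  let C := \bigcup_(i : I) D i in
  domination_property f C ->
  pareto_set f C = nondominated f C (\bigcup_(i : I) pareto_set f (D i)).
Proof.
move=> C domC.
have PC x : pareto_set f C x -> (\bigcup_(i : I) pareto_set f (D i)) x.
  move=> [[i _ Dix] ndx]; exists i => //; split=> // -[y Diy yx].
  by apply: ndx; exists y => //; exists i.
apply/seteqP; split=> [x Px|x [[_ Cx] ndx]].
  split; first by split; [exact: PC|case: Px].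
  by case=> z [_ Cz] zx; case: Px => _; apply; exists z.
(* [ndx] only excludes dominators that are Pareto in some piece, so an arbitrary dominator in [C]
   would not contradict it; a Pareto one does, through [PC]. *)
apply: contrapT => nPx; have [|z Pz zx] := domC x; first by split.
by apply: ndx; exists z => //; split; [exact: PC|case: Pz].
Qed.

Theorem corollary3p13 (R : realType) (n d : nat) (d_ge1 : (1 <= d)%N)
    (l : 'I_d -> nat) (l_ge1 : forall u : 'I_d, (1 <= l u)%N)
    (gc : forall u : 'I_d, 'I_(l u) -> 'rV[R]_n -> R) :
  let g : 'I_d -> 'rV[R]_n -> R :=
    fun u x => family_min (l_ge1 u) (fun j => gc u j x) in
  let Cij : forall i : 'I_d, 'I_(l i) -> set 'rV[R]_n :=
    fun i j => [set x | gc i j x <= 0] in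
  let C : set 'rV[R]_n := feasible g in
  [/\ C = \bigcap_(i : 'I_d) \bigcup_(j : 'I_(l i)) Cij i j,
      \bigcap_(i : 'I_d) \bigcup_(j : 'I_(l i)) Cij i j =
        \bigcup_(j : forall i : 'I_d, 'I_(l i)) \bigcap_(i : 'I_d) Cij i (j i)
    & forall (m : nat) (f : 'rV[R]_n -> 'rV[R]_m),
        domination_property f C ->
        pareto_set f (feasible g) =
          nondominated f (feasible g)
            (\bigcup_(j : forall i : 'I_d, 'I_(l i))
               pareto_set f (feasible (fun i : 'I_d => gc i (j i))))].
Proof.
move=> g Cij C.
have CE : C = \bigcap_(i : 'I_d) \bigcup_(j : 'I_(l i)) Cij i j.
  apply/seteqP; split=> x /= Cx => [i _|i].
    by have /family_min_le[j gj] := Cx i; exists j.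
  by apply/family_min_le; have [j _ gj] := Cx i Logic.I; exists j.
split=> // [|m f]; first exact: bigcap_bigcup_choice.
have CU : C =
    \bigcup_(j : forall i : 'I_d, 'I_(l i)) feasible (fun i => gc i (j i)).
  rewrite CE bigcap_bigcup_choice; apply: eq_bigcupr => j _.
  by apply/seteqP; split=> x /= Cx i; [exact: Cx|move=> _; exact: Cx].
(* The domination hypothesis is still in the goal, so [CU] rewrites it together with both sides of
   the identity. *)
rewrite -/C CU; exact: pareto_set_bigcup.
Qed.
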